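(* Let $X=\Delta([a,b])^S$. There is a sequence of experiments $\Sigma_\infty=\{B_i\}_{i\in\mathbf N}$ (satisfying the standing assumptions below) with the following property: whenever $\succeq^*$ is a continuous, weakly monotone preference on $X$, and for each $k\in\mathbf N$, $\succeq^k$ is a continuous, weakly monotone preference on $X$ that strongly rationalizes the choice function $(\Sigma_k,c_{\succeq^*})$ generated by $\succeq^*$, then $\succeq^k\to\succeq^*$ in the topology of closed convergence.
   Context: $S$ is a finite nonempty set, $a<b$ reals, $\Delta([a,b])$ the set of Borel probability measures on $[a,b]$ with the topology of weak convergence, $X=\Delta([a,b])^S$ with the product topology. For $p,q\in\Delta([a,b])$, $p\ge q$ means $p$ first-order stochastically dominates $q$ ($\int h\,dp\ge\int h\,dq$ for all bounded continuous nondecreasing $h$); for acts $f\ge g$ iff $f(s)\ge g(s)$ for every $s$. A preference on $X$ is a complete, transitive relation closed in $X\times X$; it is weakly monotone if $f\ge g$ implies $f\succeq g$. A sequence of experiments is a sequence $\Sigma_\infty=\{B_i\}_{i\in\mathbf N}$ of unordered pairs $B_i=\{x_i,y_i\}\subseteq X$; $\Sigma_k=\{B_1,\dots,B_k\}$, and $B=\bigcup_i B_i$. Standing assumptions: $B$ is dense in $X$, and for any $x,y\in B$ there is $k$ with $B_k=\{x,y\}$. For a preference $\succeq$ and a family $\Sigma$ of finite sets, the generated choice function is $c_\succeq(A)=\{x\in A:x\succeq y\ \forall y\in A\}$, $A\in\Sigma$. A preference $\succeq^k$ strongly rationalizes a choice function $(\Sigma_k,c)$ if $c(B_i)=c_{\succeq^k}(B_i)$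 for all $B_i\in\Sigma_k$. Closed convergence: for closed sets $F^n\subseteq X\times X$, $\mathrm{Li}$ is the set of points every neighborhood of which meets $F^n$ for all large $n$, $\mathrm{Ls}$ the set of points every neighborhood of which meets $F^n$ for infinitely many $n$; $F^n\to F$ iff $\mathrm{Li}=F=\mathrm{Ls}$. *)

(* Defs.v *)
From HB Require Import structures.
From mathcomp Require Import all_boot all_order all_algebra.
From mathcomp Require Import all_classical all_reals all_analysis.
Set Implicit Arguments. Unset Strict Implicit. Unset Printing Implicit Defensive.
Import Order.TTheory GRing.Theory Num.Theory numFieldNormedType.Exports.
Local Open Scope classical_set_scope.
Local Open Scope ring_scope.

(* Delta([a,b]) : Borel probability measures on R concentrated on [a,b]
   (canonically identified with Borel probability measures on [a,b]). *)
Definition Delta (R : realType) (a b : R) :=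
  {P : probability R R | P [set` `[a, b]] = 1%E}.

(* expectation of h under p (h continuous, so bounded on [a,b]) *)
Definition Eint (R : realType) (a b : R) (p : Delta a b) (h : R -> R) : R :=
  fine (\int[sval p]_(x in [set` `[a, b]]) (h x)%:E)%E.

Definition Act (R : realType) (a b : R) (S : finType) := S -> Delta a b.

Definition fosd (R : realType) (a b : R) (p q : Delta a b) : Prop :=
  forall h : R -> R, continuous h -> (forall x y, x <= y -> h x <= h y) ->
    Eint q h <= Eint p h.

Definition act_ge (R : realType) (a b : R) (S : finType) (f g : Act a b S) :=
  forall s, fosd (f s) (g s).

(* Basic open neighbourhoods of the weak(-star) product topology on
   X = Delta([a,b])^S : determined by finitely many continuous test
   functions and a radius. *)
Definition basic_nbhs (R : realType) (a b : R) (S : finType) (f : Act a b S)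
  (n : nat) (hs : 'I_n -> (R -> R)) (e : R) : set (Act a b S) :=
  [set f' | forall (j : 'I_n) (s : S), `|Eint (f' s) (hs j) - Eint (f s) (hs j)| < e].

Definition nbhsX (R : realType) (a b : R) (S : finType) (f : Act a b S)
  (U : set (Act a b S)) : Prop :=
  exists (n : nat) (hs : 'I_n -> (R -> R)) (e : R),
    (forall j, continuous (hs j)) /\ 0 < e /\ basic_nbhs f hs e `<=` U.

Definition nbhsXX (R : realType) (a b : R) (S : finType)
  (fg : Act a b S * Act a b S) (W : set (Act a b S * Act a b S)) : Prop :=
  exists U V, nbhsX fg.1 U /\ nbhsX fg.2 V /\ (U `*` V) `<=` W.

Definition closedXX (R : realType) (a b : R) (S : finType)
  (F : set (Act a b S * Act a b S)) : Prop :=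
  forall z, (forall W, nbhsXX z W -> W `&` F !=set0) -> F z.

Definition denseX (R : realType) (a b : R) (S : finType) (B : set (Act a b S)) :=
  forall f U, nbhsX f U -> U `&` B !=set0.

Definition graph (R : realType) (a b : R) (S : finType)
  (pr : Act a b S -> Act a b S -> Prop) : set (Act a b S * Act a b S) :=
  [set z | pr z.1 z.2].

Definition is_preference (R : realType) (a b : R) (S : finType)
  (pr : Act a b S -> Act a b S -> Prop) : Prop :=
  [/\ (forall f g, pr f g \/ pr g f),
      (forall f g h, pr f g -> pr g h -> pr f h) &
      closedXX (graph pr)].

(* the paper's "continuous preference": a preference (closed graph) *)
Definition continuous_pref (R : realType) (a b : R) (S : finType)
  (pr : Act a b S -> Act a b S -> Prop) := is_preference pr.

Definition weakly_monotone (R : realType) (a b : R) (S : finType)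
  (pr : Act a b S -> Act a b S -> Prop) : Prop :=
  forall f g, act_ge f g -> pr f g.

(* a sequence of experiments: B i is the unordered pair {(B i).1, (B i).2} *)
Definition in_pair (T : Type) (p : T * T) (x : T) := x = p.1 \/ x = p.2.

Definition union_B (R : realType) (a b : R) (S : finType)
  (B : nat -> Act a b S * Act a b S) : set (Act a b S) :=
  [set x | exists i, in_pair (B i) x].

Definition standing_assumptions (R : realType) (a b : R) (S : finType)
  (B : nat -> Act a b S * Act a b S) : Prop :=
  denseX (union_B B) /\
  (forall x y, union_B B x -> union_B B y ->
     exists k, B k = (x, y) \/ B k = (y, x)).

Definition choice_of (R : realType) (a b : R) (S : finType)
  (pr : Act a b S -> Act a b S -> Prop) (p : Act a b S * Act a b S) :
  set (Act a b S) :=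
  [set x | in_pair p x /\ forall y, in_pair p y -> pr x y].

Definition strongly_rationalizes (R : realType) (a b : R) (S : finType)
  (B : nat -> Act a b S * Act a b S) (k : nat)
  (prk pr : Act a b S -> Act a b S -> Prop) : Prop :=
  forall i, (i < k)%N -> choice_of prk (B i) = choice_of pr (B i).

Definition Li (R : realType) (a b : R) (S : finType)
  (F : nat -> set (Act a b S * Act a b S)) : set (Act a b S * Act a b S) :=
  [set z | forall W, nbhsXX z W -> exists N, forall n, (N <= n)%N -> W `&` F n !=set0].

Definition Ls (R : realType) (a b : R) (S : finType)
  (F : nat -> set (Act a b S * Act a b S)) : set (Act a b S * Act a b S) :=
  [set z | forall W, nbhsXX z W -> forall N, exists2 n, (N <= n)%N & W `&` F n !=set0].

Definition closed_conv (R : realType) (a b : R) (S : finType)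
  (F : nat -> set (Act a b S * Act a b S)) (G : set (Act a b S * Act a b S)) :=
  Li F = G /\ G = Ls F.

(* Main.v *)
Require Import Defs.
From HB Require Import structures.
From mathcomp Require Import all_boot all_order all_algebra.
From mathcomp Require Import all_classical all_reals all_analysis.
From mathcomp Require Import measurable_realfun ring lra zify.
Import Order.TTheory GRing.Theory Num.Theory numFieldNormedType.Exports.
Local Open Scope classical_set_scope.
Local Open Scope ring_scope.
Set Implicit Arguments. Unset Strict Implicit. Unset Printing Implicit Defensive.

(* Take for the experiments all pairs of acts whose coordinates are uniform
   distributions on finite families of grid points of [a,b]. The order of first
   order dominance squeezes: every neighbourhood of an act f contains two such acts
   x, y and a smaller neighbourhood of f whose members g all satisfy x >= g >= y.
   By weak monotonicity, a comparison between acts near (f, f') then transfers to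
   a comparison between two fixed acts of the countable family, on which the k-th
   preference agrees with the limit one for large k; this yields both inclusions.
   For the squeezing, a nondecreasing h lies between two shifted piecewise linear
   interpolations, which are nonnegative combinations of finitely many ramps up to
   a constant. Hence dominating every q near p only requires dominating the
   finitely many ramp integrals, and these can be rounded to multiples of 1/N and
   realised by N equally weighted quantiles. *)

(** * Continuous test functions and their integrals on [[a, b]] *)

(** Compactness of the segment. The conclusion is kept as a filter statement in [d], so that
    finitely many functions can later share one [d]. *)
Lemma unif_continuous_itv (R : realType) (a b : R) (h : R -> R) (e : R) :
  continuous h -> 0 < e ->
  \forall d \near 0^'+, forall x y, x \in `[a, b] -> `|x - y| < d -> `|h x - h y| < e.
Proof.
move=> hc e0.
have /compact_near_coveringP cov := @segment_compact R a b.
have := cov R 0^'+ (fun d x => forall y, `|x - y| < d -> `|h x - h y| < e) _.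
have H : forall x : R, [set` `[a, b]] x -> \forall x' \near x & d \near 0^'+,
    (forall y, `|x' - y| < d -> `|h x' - h y| < e).
  move=> x _.
  have e2 : 0 < e / 2 by lra.
  have /cvgrPdist_lt /(_ _ e2) /nbhs_ballP[r /= r0 xr] := hc x.
  have r2 : 0 < r / 2 by lra.
  exists (ball x (r / 2), [set d | d < r / 2]) => /=.
    by split; [exact: nbhsx_ballx|exact: nbhs_right_lt].
  move=> [x' d] [/= xx' dr] y x'y.
  have {}xx' : `|x - x'| < r / 2 by [].
  have {}dr : d < r / 2 by [].
  have {}xr z : `|x - z| < r -> `|h x - h z| < e / 2 := xr z.
  have h1 := xr x' ltac:(lra).
  have h2 : `|h x - h y| < e / 2.
    apply: xr; apply: le_lt_trans (ler_distD x' x y) _.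
    by rewrite [r]splitr ltrD// (lt_trans x'y).
  apply: le_lt_trans (ler_distD (h x) (h x') (h y)) _.
  by rewrite [e]splitr ltrD// distrC.
move=> /(_ _ H); apply: filterS => d dP x y xab xy.
exact: (dP x xab).
Qed.

Lemma continuous_itv_bounded (R : realType) (a b : R) (h : R -> R) :
  continuous h -> exists M, forall x, x \in `[a, b] -> `|h x| <= M.
Proof.
move=> hc.
have /compact_bounded[M [_ hM]] : compact (h @` [set` `[a, b]]).
  apply: continuous_compact; last exact: segment_compact.
  exact: continuous_subspaceT.
exists (M + 1) => x xab; apply: hM; first by rewrite ltrDl.
by exists x.
Qed.

Lemma continuous_integrable (R : realType) (a b : R) (p : Delta a b) (h : R -> R) :
  continuous h -> (sval p).-integrable [set` `[a, b]] (EFin \o h).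
Proof.
move=> hc; apply: measurable_bounded_integrable => //.
- by rewrite (le_lt_trans (probability_le1 _ _))// ltry.
- by apply: measurable_funTS; exact: continuous_measurable_fun.
- have [M hM] := @continuous_itv_bounded R a b h hc.
  by exists M; split=> [|r /ltW Mr x xab]; rewrite ?num_real//; exact: le_trans (hM x xab) Mr.
Qed.

Lemma Eint_le (R : realType) (a b : R) (p : Delta a b) (h g : R -> R) :
  continuous h -> continuous g -> (forall x, x \in `[a, b] -> h x <= g x) ->
  Eint p h <= Eint p g.
Proof.
by move=> hc gc hg; apply: le_Rintegral => //; exact: continuous_integrable.
Qed.

Lemma Eint_cst (R : realType) (a b : R) (p : Delta a b) (c : R) :
  Eint p (cst c) = c.
Proof.
by rewrite /Eint -/(Rintegral _ _ _) Rintegral_cst//= (svalP p) mulr1.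
Qed.

Lemma EintD (R : realType) (a b : R) (p : Delta a b) (h g : R -> R) :
  continuous h -> continuous g -> Eint p (fun x => h x + g x) = Eint p h + Eint p g.
Proof. by move=> hc gc; apply: RintegralD => //; exact: continuous_integrable. Qed.

Lemma EintZ (R : realType) (a b : R) (p : Delta a b) (c : R) (h : R -> R) :
  continuous h -> Eint p (fun x => c * h x) = c * Eint p h.
Proof. by move=> hc; apply: RintegralZl => //; exact: continuous_integrable. Qed.

Lemma continuous_sum (R : realType) (N : nat) (h : nat -> R -> R) :
  (forall i, continuous (h i)) -> continuous (fun x => \sum_(i < N) h i x).
Proof.
move=> hc; elim: N => [|N cN].
  rewrite (_ : (fun x => _) = cst 0); first exact: cst_continuous.
  by apply/funext => x; rewrite big_ord0.
rewrite (_ : (fun x => _) = (fun x => \sum_(i < N) h i x + h N x)).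
  by move=> x; apply: continuousD; [exact: cN|exact: hc].
by apply/funext => x; rewrite big_ord_recr.
Qed.

Lemma continuous_scale (R : realType) (c : R) (h : R -> R) :
  continuous h -> continuous (fun x => c * h x).
Proof. by move=> hc x; apply: continuousM; [exact: cst_continuous|exact: hc]. Qed.

Lemma Eint_sum (R : realType) (a b : R) (p : Delta a b) (N : nat) (h : nat -> R -> R) :
  (forall i, continuous (h i)) ->
  Eint p (fun x => \sum_(i < N) h i x) = \sum_(i < N) Eint p (h i).
Proof.
move=> hc; elim: N => [|N EN].
  rewrite big_ord0 (_ : (fun x => _) = cst 0) ?Eint_cst//.
  by apply/funext => x; rewrite big_ord0.
rewrite big_ord_recr/= -EN -EintD//; last exact: continuous_sum.
by rewrite (_ : (fun x => _) = (fun x => \sum_(i < N) h i x + h N x))//;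
  apply/funext => x; rewrite big_ord_recr.
Qed.

(** * Uniform distributions on finite families of points *)

Definition unif_meas (R : realType) (z : nat -> R) (n : nat) : set R -> \bar R :=
  mscale (n.+1%:R^-1)%:nng (msum (fun k => \d_(z k)) n.+1).

HB.instance Definition _ (R : realType) (z : nat -> R) (n : nat) :=
  Measure.on (unif_meas z n).

(** Used twice: with the whole line to obtain a probability, and with [[a, b]] to obtain a member of
    [Delta a b]. *)
Lemma unif_meas_full (R : realType) (z : nat -> R) (n : nat) (A : set R) :
  (forall k, A (z k)) -> unif_meas z n A = 1%E.
Proof.
move=> Az; rewrite /unif_meas /mscale /= /msum.
rewrite (eq_bigr (fun=> 1%E)) => [|k _]; last by rewrite [LHS]diracE mem_set.
by rewrite sumEFin -EFinM sumr_const card_ord mulVf.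
Qed.

HB.instance Definition _ (R : realType) (z : nat -> R) (n : nat) :=
  Measure_isProbability.Build _ _ _ (unif_meas z n)
    (unif_meas_full (A := setT) n (fun k => I)).

Definition unif_Delta (R : realType) (a b : R) (z : nat -> R)
    (zab : forall k, z k \in `[a, b]) (n : nat) : Delta a b :=
  exist _ (unif_meas z n : probability R R) (unif_meas_full n zab).

Lemma Eint_unif (R : realType) (a b : R) (z : nat -> R)
    (zab : forall k, z k \in `[a, b]) (n : nat) (h : R -> R) :
  continuous h ->
  Eint (unif_Delta zab n) h = n.+1%:R^-1 * \sum_(k < n.+1) h (z k).
Proof.
move=> hc.
have [C hC] := @continuous_itv_bounded R a b h hc.
have h0 x : x \in `[a, b] -> 0 <= h x + C.
  by move=> /hC; rewrite ler_norml => /andP[+ _]; rewrite -subr_ge0 opprK.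
(* Shifting [h] by a bound [C] makes the integrand nonnegative, as required to split the integral
   over a scaled sum of measures. *)
have -> : Eint (unif_Delta zab n) h = Eint (unif_Delta zab n) (fun x => h x + C) - C.
  by rewrite (@EintD _ _ _ _ h (cst C))// ?Eint_cst ?addrK//; exact: cst_continuous.
have mh : measurable_fun [set` `[a, b]] (fun x => (h x + C)%:E).
  apply/measurable_EFinP; apply: measurable_funTS; apply: continuous_measurable_fun => x.
  by apply: continuousD; [exact: hc|exact: cst_continuous].
have h0E x : [set` `[a, b]] x -> (0 <= (h x + C)%:E)%E.
  by move=> xab; rewrite lee_fin h0.
rewrite /Eint /= ge0_integral_mscale// ge0_integral_measure_sum//.
rewrite (eq_bigr (fun k : 'I_n.+1 => (h (z k) + C)%:E)) => [|k _]; last first.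
  by rewrite [LHS]integral_dirac// diracE mem_set ?mul1e//; exact: zab.
rewrite sumEFin -EFinM /= big_split/= sumr_const card_ord mulrDr -[C *+ _]mulr_natl.
by rewrite mulKf ?addrK.
Qed.

(** * Linear interpolation at the integers, and quantiles *)

Definition clamp (R : realType) (t : R) : R := Num.max 0 (Num.min 1 t).

Lemma clamp_itv (R : realType) (t : R) : 0 <= clamp t <= 1.
Proof. by rewrite /clamp le_max lexx/= ge_max ler01 ge_min lexx. Qed.

Lemma clamp_id (R : realType) (t : R) : 0 <= t <= 1 -> clamp t = t.
Proof. by case/andP=> t0 t1; rewrite /clamp min_r// max_r. Qed.

Lemma clamp_eq0 (R : realType) (t : R) : t <= 0 -> clamp t = 0.
Proof. by move=> t0; rewrite /clamp min_r ?max_l// (le_trans t0). Qed.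

Lemma clamp_eq1 (R : realType) (t : R) : 1 <= t -> clamp t = 1.
Proof. by move=> t1; rewrite /clamp min_l// max_r. Qed.

Lemma le_clamp (R : realType) : {homo @clamp R : s t / s <= t}.
Proof.
move=> s t st; have [s0|s0] := leP s 0.
  by rewrite (clamp_eq0 s0); case/andP: (clamp_itv t).
have [t1|t1] := leP 1 t; first by rewrite (clamp_eq1 t1); case/andP: (clamp_itv s).
by rewrite !clamp_id//; lra.
Qed.

Lemma continuous_clamp (R : realType) : continuous (@clamp R).
Proof.
move=> t; apply: continuous_max; first exact: cst_continuous.
by apply: continuous_min; [exact: cst_continuous|exact: id].
Qed.

(** On the cell of [y] with index [k], the earlier clamps equal 1 and telescope to [G k - G 0], the
    later ones vanish, and the one of index [k] contributes the slope term with [l = y - k]. *)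
Lemma clamp_interp (R : realType) (G : nat -> R) (N : nat) (y : R) :
  0 <= y <= N.+1%:R -> exists k l, [/\ (k <= N)%N, 0 <= l <= 1,
    k%:R <= y <= k.+1%:R &
    G 0%N + \sum_(i < N.+1) (G i.+1 - G i) * clamp (y - i%:R) =
      (1 - l) * G k + l * G k.+1].
Proof.
elim: N => [|N IH] yN.
  exists 0%N, y; split => //; rewrite big_ord1 subr0 clamp_id//; lra.
have [yle|ylt] := leP y N.+1%:R.
  have [|k [l [kN l01 ky E]]] := IH; first by lra.
  exists k, l; split=> //; first exact: leqW.
  by rewrite big_ord_recr/= addrA E (@clamp_eq0 _ (_ - _)) ?mulr0 ?addr0//; lra.
have yN2 : y <= N.+1%:R + 1 by move: yN; rewrite -[in N.+2%:R]natr1; lra.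
exists N.+1, (y - N.+1%:R); split=> //; [lra|lra|].
rewrite big_ord_recr/= clamp_id; last lra.
rewrite (eq_bigr (fun i : 'I_N.+1 => G i.+1 - G i)) => [|i _]; last first.
  rewrite clamp_eq1 ?mulr1//.
  have : i.+1%:R <= N.+1%:R :> R by rewrite ler_nat.
  by rewrite -[in i.+1%:R]natr1; lra.
rewrite -(big_mkord xpredT (fun i => G i.+1 - G i)) telescope_sumr//.
by ring.
Qed.

(* The generalised inverse of the step function [i |-> C i]. *)
Definition quant (C : nat -> nat) (m k : nat) : nat := (\sum_(i < m) (k < C i))%N.

(** As [C] is nonincreasing, the indices with [k < C i] form an initial segment of length
    [quant C m k], over which the increments of [G] telescope. *)
Lemma quant_telescope (R : realType) (G : nat -> R) (C : nat -> nat) (m k : nat) :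
  (forall i, (C i.+1 <= C i)%N) ->
  \sum_(i < m) (G i.+1 - G i) * (k < C i)%:R = G (quant C m k) - G 0%N.
Proof.
move=> Cd; elim: m => [|m IH]; first by rewrite /quant !big_ord0 subrr.
rewrite big_ord_recr/= IH /quant big_ord_recr/=.
have [kC|_] := ltnP k (C m); last by rewrite mulr0 addr0 addn0.
have -> : (\sum_(i < m) (k < C i) = m)%N.
  rewrite (eq_bigr (fun=> 1%N)) => [|i _]; first by rewrite sum_nat_const card_ord muln1.
  have Cmi : (C m <= C i)%N.
    apply: (homo_leq (f := C) (r := fun x y => (y <= x)%N) _ _ Cd) => //; last exact: ltnW.
    by move=> ? ? ? ? /leq_trans; apply.
  by rewrite (leq_trans kC Cmi).
by rewrite addn1 mulr1 addrC addrA subrK.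
Qed.

(** Summation by layers: after exchanging the sums, the increment at [i] is counted once for each
    [k < M] with [k < C i], that is [C i] times because [C i <= M]. *)
Lemma sum_quant (R : realType) (G : nat -> R) (C : nat -> nat) (m M : nat) :
  (forall i, (C i.+1 <= C i)%N) -> (forall i, (C i <= M)%N) ->
  \sum_(k < M) G (quant C m k) =
    M%:R * G 0%N + \sum_(i < m) (G i.+1 - G i) * (C i)%:R.
Proof.
move=> Cd CM.
have -> : \sum_(i < m) (G i.+1 - G i) * (C i)%:R =
    \sum_(k < M) (G (quant C m k) - G 0%N).
  under [RHS]eq_bigr do rewrite -quant_telescope//.
  rewrite exchange_big/=; apply: eq_bigr => i _; rewrite -mulr_sumr; congr (_ * _).
  rewrite -natr_sum; congr (_%:R).
  rewrite -(big_mkord xpredT (fun k => nat_of_bool (k < C i)%N)) (big_cat_nat (n := C i))//=.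
  rewrite [X in (_ + X)%N]big_nat_cond [X in (_ + X)%N]big1 => [|k]; last first.
    by rewrite andbT => /andP[ck _]; rewrite ltnNge ck.
  rewrite big_nat_cond (eq_bigr (fun=> 1%N)) => [|k]; last first.
    by rewrite andbT => /andP[_ ->].
  by rewrite -big_nat_cond sum_nat_const_nat subn0 muln1 addn0.
rewrite big_split/= sumr_const card_ord mulNrn -[G 0%N *+ _]mulr_natl; ring.
Qed.

(** * Monotone rounding to multiples of [1 / N.+1] *)

Lemma round_up (R : realType) (rho : nat -> R) (N : nat) :
  (forall i, 0 <= rho i <= 1) -> (forall i, rho i.+1 <= rho i) ->
  exists C : nat -> nat, [/\ forall i, (C i.+1 <= C i)%N,
    forall i, (C i <= N.+1)%N,
    forall i, `|(C i)%:R - N.+1%:R * rho i| <= 2 &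
    forall i r, r <= 1 -> `|r - rho i| < N.+1%:R^-1 -> N.+1%:R * r <= (C i)%:R].
Proof.
move=> r01 rd; have N0 : 0 < N.+1%:R :> R by rewrite ltr0n.
(* One unit lifts the truncation above [N.+1 * rho i], the other absorbs a perturbation of [rho i]
   by [1 / N.+1]. The cap at [N.+1] is harmless because [r <= 1]. *)
exists (fun i => minn N.+1 (Num.truncn (N.+1%:R * rho i)).+2).
have trunc i : (Num.truncn (N.+1%:R * rho i))%:R <= N.+1%:R * rho i
    < (Num.truncn (N.+1%:R * rho i))%:R + 1.
  by rewrite natr1 truncn_itv// mulr_ge0//; case/andP: (r01 i).
split=> i.
- have : (Num.truncn (N.+1%:R * rho i.+1) <= Num.truncn (N.+1%:R * rho i))%N.
    by apply: le_truncn; exact: ler_wpM2l (ltW N0) _ _ (rd i).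
  lia.
- exact: geq_minl.
- have := trunc i; set T := Num.truncn _ => TT.
  have : N.+1%:R * rho i <= N.+1%:R by rewrite ler_piMr//; case/andP: (r01 i).
  rewrite ler_norml; case: leqP => [|]; rewrite -(ler_nat R) -(addn2 T) natrD; lra.
- move=> r r1 rr.
  have {}rr : N.+1%:R * (r - rho i) <= 1.
    by rewrite -ler_pdivlMl// mulr1 (le_trans (ler_norm _))// ltW.
  have := trunc i; set T := Num.truncn _ => TT.
  have : N.+1%:R * r <= N.+1%:R by rewrite ler_piMr.
  case: leqP => // _; rewrite -(addn2 T) natrD; lra.
Qed.

Lemma round_down (R : realType) (rho : nat -> R) (N : nat) :
  (forall i, 0 <= rho i <= 1) -> (forall i, rho i.+1 <= rho i) ->
  exists C : nat -> nat, [/\ forall i, (C i.+1 <= C i)%N,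
    forall i, (C i <= N.+1)%N,
    forall i, `|(C i)%:R - N.+1%:R * rho i| <= 2 &
    forall i r, 0 <= r -> `|r - rho i| < N.+1%:R^-1 -> (C i)%:R <= N.+1%:R * r].
Proof.
move=> r01 rd; have N0 : 0 < N.+1%:R :> R by rewrite ltr0n.
(* One unit below the truncation absorbs the perturbation; when the truncation is 0, the predecessor
   stays 0 and [0 <= r] suffices. *)
exists (fun i => (Num.truncn (N.+1%:R * rho i)).-1).
have trunc i : (Num.truncn (N.+1%:R * rho i))%:R <= N.+1%:R * rho i
    < (Num.truncn (N.+1%:R * rho i))%:R + 1.
  by rewrite natr1 truncn_itv// mulr_ge0//; case/andP: (r01 i).
have pred (n : nat) : n%:R - 1 <= (n.-1%:R : R) <= n%:R.
  by case: n => [|n] /=; rewrite -?natr1; lra.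
split=> i.
- have : (Num.truncn (N.+1%:R * rho i.+1) <= Num.truncn (N.+1%:R * rho i))%N.
    by apply: le_truncn; exact: ler_wpM2l (ltW N0) _ _ (rd i).
  lia.
- have := trunc i; set T := Num.truncn _ => TT.
  have rN : N.+1%:R * rho i <= N.+1%:R by rewrite ler_piMr//; case/andP: (r01 i).
  by rewrite (leq_trans (leq_pred _))// -(ler_nat R); lra.
- by have := trunc i; set T := Num.truncn _ => TT; have := pred T; rewrite ler_norml; lra.
- move=> r r0 rr.
  have {}rr : N.+1%:R * (rho i - r) <= 1.
    by rewrite -ler_pdivlMl// mulr1 (le_trans (ler_norm _))// distrC ltW.
  have := trunc i; set T := Num.truncn _ => TT.
  have : 0 <= N.+1%:R * r by rewrite mulr_ge0.
  case: T TT => [|T] /=; rewrite -?natr1; lra.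
Qed.

(** * Grid, ramps and shifted interpolants on [[a, b]] *)

Definition mesh (R : realType) (a b : R) (N : nat) : R := (b - a) / N.+1%:R.

(** The cap at [N.+1] keeps nodes inside [[a, b]] when [succn] pushes an index past the last one. *)
Definition grid (R : realType) (a b : R) (N i : nat) : R :=
  a + (minn i N.+1)%:R * mesh a b N.

(** A continuous substitute for the indicator of a half-line, so that its integral is controlled by
    weak neighbourhoods. *)
Definition ramp (R : realType) (a b : R) (N i : nat) (x : R) : R :=
  clamp ((x - a) / mesh a b N - i%:R).

Lemma mesh_gt0 (R : realType) (a b : R) (N : nat) : a < b -> 0 < mesh a b N.
Proof. by move=> ab; rewrite divr_gt0 ?subr_gt0 ?ltr0n. Qed.

Lemma meshE (R : realType) (a b : R) (N : nat) : N.+1%:R * mesh a b N = b - a.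
Proof. by rewrite mulrC divfK// pnatr_eq0. Qed.

Lemma grid_itv (R : realType) (a b : R) (N i : nat) : a < b -> grid a b N i \in `[a, b].
Proof.
move=> ab; have d0 := mesh_gt0 N ab; rewrite in_itv/= /grid.
have : (minn i N.+1)%:R * mesh a b N <= b - a.
  by rewrite -(meshE a b N) ler_pM2r// ler_nat geq_minr.
have : 0 <= (minn i N.+1)%:R * mesh a b N by rewrite mulr_ge0// ltW.
by move=> ? ?; apply/andP; split; lra.
Qed.

Lemma le_grid (R : realType) (a b : R) (N i j : nat) :
  a < b -> (i <= j)%N -> grid a b N i <= grid a b N j.
Proof.
move=> ab ij; rewrite lerD2l ler_pM2r ?mesh_gt0// ler_nat; lia.
Qed.

Lemma mesh_coord (R : realType) (a b x : R) (N : nat) :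
  a < b -> x \in `[a, b] -> 0 <= (x - a) / mesh a b N <= N.+1%:R.
Proof.
move=> ab; rewrite in_itv/= => /andP[ax xb]; have d0 := mesh_gt0 N ab.
by rewrite divr_ge0 ?subr_ge0 ?(ltW d0)//= ler_pdivrMr// meshE lerB.
Qed.

Lemma ramp_itv (R : realType) (a b : R) (N i : nat) (x : R) : 0 <= ramp a b N i x <= 1.
Proof. exact: clamp_itv. Qed.

Lemma ramp_decr (R : realType) (a b : R) (N i : nat) (x : R) :
  ramp a b N i.+1 x <= ramp a b N i x.
Proof. by apply: le_clamp; rewrite lerB// ler_nat. Qed.

Lemma continuous_ramp (R : realType) (a b : R) (N i : nat) : continuous (ramp a b N i).
Proof.
move=> x; apply: (@continuous_comp _ _ _ (fun x => (x - a) / mesh a b N - i%:R)).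
  apply: continuousB; last exact: cst_continuous.
  apply: continuousM; last exact: cst_continuous.
  by apply: continuousB; [exact: id|exact: cst_continuous].
exact: continuous_clamp.
Qed.

Lemma Eint_ramp_itv (R : realType) (a b : R) (N i : nat) (p : Delta a b) :
  0 <= Eint p (ramp a b N i) <= 1.
Proof.
rewrite -{1}(Eint_cst p 0) -(Eint_cst p 1).
apply/andP; split; apply: Eint_le => //; try exact: continuous_ramp;
  try exact: cst_continuous; by move=> x _; case/andP: (ramp_itv a b N i x).
Qed.

Lemma Eint_ramp_decr (R : realType) (a b : R) (N i : nat) (p : Delta a b) :
  Eint p (ramp a b N i.+1) <= Eint p (ramp a b N i).
Proof.
by apply: Eint_le => [||x _]; [exact: continuous_ramp..|exact: ramp_decr].
Qed.

(* For [s = id] this is the piecewise linear interpolation of [h] on the grid;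
   [s = succn] and [s = predn] shift it above and below a nondecreasing [h]. *)
Definition interp (R : realType) (a b : R) (N : nat) (s : nat -> nat) (h : R -> R)
    (x : R) : R :=
  h (grid a b N (s 0%N)) +
  \sum_(i < N.+1) (h (grid a b N (s i.+1)) - h (grid a b N (s i))) * ramp a b N i x.

Lemma interpE (R : realType) (a b : R) (N : nat) (s : nat -> nat) (h : R -> R) (x : R) :
  a < b -> x \in `[a, b] -> exists k l, [/\ (k <= N)%N, 0 <= l <= 1,
    a + k%:R * mesh a b N <= x <= a + k.+1%:R * mesh a b N &
    interp a b N s h x =
      (1 - l) * h (grid a b N (s k)) + l * h (grid a b N (s k.+1))].
Proof.
move=> ab xab.
have [k [l [kN l01 ky E]]] :=
  clamp_interp (fun i => h (grid a b N (s i))) (mesh_coord N ab xab).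
exists k, l; split=> //.
have d0 := mesh_gt0 N ab.
by move: ky; rewrite ler_pdivlMr// ler_pdivrMr// => /andP[? ?]; apply/andP; split; lra.
Qed.

Lemma continuous_interp (R : realType) (a b : R) (N : nat) (s : nat -> nat) (h : R -> R) :
  continuous (interp a b N s h).
Proof.
move=> x; apply: continuousD; first exact: cst_continuous.
pose g i x := (h (grid a b N (s i.+1)) - h (grid a b N (s i))) * ramp a b N i x.
have gc i : continuous (g i).
  exact/continuous_scale/continuous_ramp.
exact: (continuous_sum gc).
Qed.

Lemma Eint_interp (R : realType) (a b : R) (N : nat) (s : nat -> nat) (h : R -> R)
    (p : Delta a b) :
  Eint p (interp a b N s h) = h (grid a b N (s 0%N)) +
    \sum_(i < N.+1) (h (grid a b N (s i.+1)) - h (grid a b N (s i))) *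
      Eint p (ramp a b N i).
Proof.
pose g i x := (h (grid a b N (s i.+1)) - h (grid a b N (s i))) * ramp a b N i x.
have gc i : continuous (g i).
  exact/continuous_scale/continuous_ramp.
rewrite (@EintD _ _ _ p (cst (h (grid a b N (s 0%N)))) (fun x => \sum_(i < N.+1) g i x)).
- rewrite Eint_cst (Eint_sum _ _ gc); congr (_ + _); apply: eq_bigr => i _.
  by rewrite EintZ//; exact: continuous_ramp.
- exact: cst_continuous.
- exact: continuous_sum.
Qed.

(** On cell [k] the interpolant averages the values of [h] at nodes [k.+1] and [k.+2], neither of
    which lies to the left of [x], except that node [k.+2] may coincide with [k.+1] at the cap. *)
Lemma interp_succn_ge (R : realType) (a b : R) (N : nat) (h : R -> R) (x : R) :
  a < b -> {homo h : x y / x <= y} -> x \in `[a, b] -> h x <= interp a b N succn h x.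
Proof.
move=> ab hm xab; have [k [l [kN l01 /andP[_ xk] ->]]] := interpE N succn h ab xab.
have h1 : h x <= h (grid a b N k.+1).
  by apply: hm; rewrite (le_trans xk)// /grid (minn_idPl _).
have h2 : h (grid a b N k.+1) <= h (grid a b N k.+2) by apply/hm/le_grid.
by nra.
Qed.

Lemma interp_predn_le (R : realType) (a b : R) (N : nat) (h : R -> R) (x : R) :
  a < b -> {homo h : x y / x <= y} -> x \in `[a, b] -> interp a b N predn h x <= h x.
Proof.
move=> ab hm xab; have [k [l [kN l01 /andP[kx _] ->]]] := interpE N predn h ab xab.
have h1 : h (grid a b N k) <= h x.
  by apply: hm; rewrite (le_trans _ kx)// /grid (minn_idPl _)// leqW.
have h2 : h (grid a b N k.-1) <= h (grid a b N k) by apply/hm/le_grid => //; exact: leq_pred.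
by rewrite /=; nra.
Qed.

Definition osc_le (R : realType) (a b : R) (h : R -> R) (d w : R) :=
  forall x y, x \in `[a, b] -> y \in `[a, b] -> `|x - y| <= d -> `|h x - h y| <= w.

(** Covers both [succn] and [predn], so that one error estimate serves the upper and the lower
    measure. *)
Definition near_shift (s : nat -> nat) := forall i, (i.-1 <= s i <= i.+1)%N.

Lemma grid_step (R : realType) (a b : R) (N i : nat) (s : nat -> nat) :
  a < b -> near_shift s ->
  `|grid a b N (s i.+1) - grid a b N (s i)| <= 3 * mesh a b N.
Proof.
move=> ab ns; have d0 := mesh_gt0 N ab.
have := ns i; have := ns i.+1; rewrite /grid.
set m := minn (s i.+1) _; set m' := minn (s i) _ => n1 n2.
(* Before capping, [s i.+1] lies between [i] and [i.+2] and [s i] between [i.-1] and [i.+1]: the gap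
   is at most three meshes. *)
have m1 : m%:R <= m'.+3%:R :> R by rewrite ler_nat /m /m'; lia.
have m2 : m'%:R <= m.+1%:R :> R by rewrite ler_nat /m /m'; lia.
by move: m1 m2; rewrite -!natr1 ler_norml => m1 m2; apply/andP; split; nra.
Qed.

Lemma interp_close (R : realType) (a b : R) (N : nat) (s : nat -> nat) (h : R -> R)
    (w x : R) :
  a < b -> near_shift s -> osc_le a b h (3 * mesh a b N) w -> x \in `[a, b] ->
  `|interp a b N s h x - h x| <= w.
Proof.
move=> ab ns hw xab; have d0 := mesh_gt0 N ab.
have [k [l [kN l01 kx ->]]] := interpE N s h ab xab.
(* Both nodes in the convex combination have index between [k.-1] and [k.+2], while [x] lies in cell
   [k]. *)
have near j : (k <= j.+1)%N -> (j <= k.+2)%N -> `|h (grid a b N j) - h x| <= w.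
  move=> kj jk; apply: hw => //; first exact: grid_itv.
  rewrite /grid; set m := minn _ _.
  have m1 : k%:R <= m.+1%:R :> R by rewrite ler_nat /m; lia.
  have m2 : m%:R <= k.+2%:R :> R by rewrite ler_nat /m; lia.
  move: kx m1 m2; rewrite -!natr1 ler_norml => kx m1 m2; nra.
have h1 : `|h (grid a b N (s k)) - h x| <= w by have nk := ns k; apply: near; lia.
have h2 : `|h (grid a b N (s k.+1)) - h x| <= w by have nk := ns k.+1; apply: near; lia.
move: h1 h2; rewrite !ler_norml => /andP[h1 h1'] /andP[h2 h2'].
by apply/andP; split; nra.
Qed.

(** * Countably many measures that bracket weak neighbourhoods *)

(** The first component fixes both the mesh and the number of atoms; missing entries default to node
    0, so every code denotes a measure. *)
Definition code_meas (R : realType) (a b : R) (ab : a < b) (c : nat * seq nat) :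
    Delta a b :=
  unif_Delta (fun k => grid_itv c.1 (nth 0%N c.2 k) ab) c.1.

Definition quant_code (N : nat) (s C : nat -> nat) : nat * seq nat :=
  (N, mkseq (fun k => s (quant C N.+1 k)) N.+1).

(** Same shape as [Eint_interp], with [C i / N.+1] in place of the ramp integrals, so the two can be
    compared term by term. *)
Lemma Eint_quant_code (R : realType) (a b : R) (ab : a < b) (N : nat)
    (s C : nat -> nat) (h : R -> R) :
  (forall i, (C i.+1 <= C i)%N) -> (forall i, (C i <= N.+1)%N) -> continuous h ->
  Eint (code_meas ab (quant_code N s C)) h = h (grid a b N (s 0%N)) +
    \sum_(i < N.+1) (h (grid a b N (s i.+1)) - h (grid a b N (s i))) *
      ((C i)%:R / N.+1%:R).
Proof.
move=> Cd CN hc; rewrite Eint_unif//=.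
under eq_bigr => k _ do rewrite nth_mkseq//.
rewrite (sum_quant (fun i => h (grid a b N (s i))))// mulrDr mulKf ?pnatr_eq0//.
congr (_ + _); rewrite mulr_sumr; apply: eq_bigr => i _.
by rewrite mulrCA [_^-1 * _]mulrC.
Qed.

(** Interpolation costs [w]. Rounding costs [2 * w]: there are [N.+1] terms, each an increment of at
    most [w] times a rounding error of at most [2 / N.+1]. *)
Lemma quant_code_close (R : realType) (a b : R) (ab : a < b) (N : nat)
    (s C : nat -> nat) (p : Delta a b) (h : R -> R) (w : R) :
  near_shift s -> (forall i, (C i.+1 <= C i)%N) -> (forall i, (C i <= N.+1)%N) ->
  (forall i, `|(C i)%:R - N.+1%:R * Eint p (ramp a b N i)| <= 2) ->
  continuous h -> osc_le a b h (3 * mesh a b N) w ->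
  `|Eint (code_meas ab (quant_code N s C)) h - Eint p h| <= 3 * w.
Proof.
move=> ns Cd CN Cr hc hw.
have N0 : 0 < N.+1%:R :> R by rewrite ltr0n.
have ci := @continuous_interp R a b N s h.
have close : `|Eint p (interp a b N s h) - Eint p h| <= w.
  have up : Eint p (interp a b N s h) <= Eint p h + w.
    rewrite -[X in _ + X](Eint_cst p w) -EintD//; last exact: cst_continuous.
    apply: Eint_le => // [x|x xab].
      by apply: continuousD; [exact: hc|exact: cst_continuous].
    by have := interp_close ab ns hw xab; rewrite ler_norml /=; lra.
  have lo : Eint p h <= Eint p (interp a b N s h) + w.
    rewrite -[X in _ + X](Eint_cst p w) -EintD//; last exact: cst_continuous.
    apply: Eint_le => // [x|x xab].
      by apply: continuousD; [exact: ci|exact: cst_continuous].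
    by have := interp_close ab ns hw xab; rewrite ler_norml /=; lra.
  by rewrite ler_norml; apply/andP; split; lra.
have round : `|Eint (code_meas ab (quant_code N s C)) h - Eint p (interp a b N s h)|
    <= 2 * w.
  rewrite Eint_quant_code// Eint_interp opprD addrACA subrr add0r -sumrB.
  rewrite (le_trans (ler_norm_sum _ _ _))//.
  rewrite (@le_trans _ _ (\sum_(i < N.+1) w * (2 / N.+1%:R)))//; last first.
    rewrite sumr_const card_ord -[X in X <= _]mulr_natl mulrCA [_ * (2 / _)]mulrC.
    by rewrite divfK ?lt0r_neq0// mulrC.
  apply: ler_sum => i _; rewrite -mulrBr normrM ler_pM//.
    by apply: hw; [exact: grid_itv..|exact: grid_step].
  rewrite ler_pdivlMr// -[X in _ * X](gtr0_norm N0) -normrM mulrBl divfK ?lt0r_neq0//.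
  by rewrite [_ * N.+1%:R]mulrC.
by have := ler_distD (Eint p (interp a b N s h))
  (Eint (code_meas ab (quant_code N s C)) h) (Eint p h); lra.
Qed.

(** The increments of a nondecreasing [h] are nonnegative, so one-sided bounds on the [N.+1] ramp
    integrals of [q] give dominance for all such [h] at once. *)
Lemma code_bracket (R : realType) (a b : R) (ab : a < b) (N : nat) (p : Delta a b) :
  exists cu cl : nat * seq nat,
    (forall h w, continuous h -> osc_le a b h (3 * mesh a b N) w ->
       `|Eint (code_meas ab cu) h - Eint p h| <= 3 * w /\
       `|Eint (code_meas ab cl) h - Eint p h| <= 3 * w) /\
    (forall q : Delta a b,
       (forall i : 'I_N.+1,
          `|Eint q (ramp a b N i) - Eint p (ramp a b N i)| < N.+1%:R^-1) ->
       fosd (code_meas ab cu) q /\ fosd q (code_meas ab cl)).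
Proof.
have N0 : 0 < N.+1%:R :> R by rewrite ltr0n.
have [Cu [Cud CuN Cur Cuq]] := round_up N
  (fun i => Eint_ramp_itv N i p) (fun i => Eint_ramp_decr N i p).
have [Cl [Cld ClN Clr Clq]] := round_down N
  (fun i => Eint_ramp_itv N i p) (fun i => Eint_ramp_decr N i p).
exists (quant_code N succn Cu), (quant_code N predn Cl); split.
  by move=> h w hc hw; split; apply: quant_code_close => // i; lia.
move=> q qp; split=> h hc hm.
  apply: (@le_trans _ _ (Eint q (interp a b N succn h))).
    by apply: Eint_le => //; [exact: continuous_interp|move=> x; exact: interp_succn_ge].
  rewrite Eint_interp Eint_quant_code// lerD2l; apply: ler_sum => i _.
  apply: ler_wpM2l; first by rewrite subr_ge0; apply/hm/le_grid.
  rewrite ler_pdivlMr// mulrC; apply: Cuq => //.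
  by case/andP: (Eint_ramp_itv N i q).
apply: (@le_trans _ _ (Eint q (interp a b N predn h))); last first.
  by apply: Eint_le => //; [exact: continuous_interp|move=> x; exact: interp_predn_le].
rewrite Eint_interp Eint_quant_code// lerD2l; apply: ler_sum => i _.
apply: ler_wpM2l; first by rewrite subr_ge0; apply/hm/le_grid => //=; lia.
rewrite ler_pdivrMr// mulrC; apply: Clq => //.
by case/andP: (Eint_ramp_itv N i q).
Qed.

Lemma osc_mesh (R : realType) (a b : R) (n : nat) (hs : 'I_n -> R -> R) (w : R) :
  a < b -> (forall j, continuous (hs j)) -> 0 < w ->
  exists N, forall j, osc_le a b (hs j) (3 * mesh a b N) w.
Proof.
move=> ab hc w0.
have : \forall d \near 0^'+, forall j x y, x \in `[a, b] -> `|x - y| < d ->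
    `|hs j x - hs j y| < w.
  by apply: filter_forall => j; exact: unif_continuous_itv.
move=> H; have [d [d0 dP]] : exists d, 0 < d /\ forall j x y, x \in `[a, b] ->
    `|x - y| < d -> `|hs j x - hs j y| < w.
  by apply: (@filter_ex _ 0^'+); apply: filterI => //; exact: nbhs_right_gt.
(* This [N] gives [3 * (b - a) / N.+1 < d]. *)
exists (Num.truncn (3 * (b - a) / d)) => j x y xab _ xy.
apply/ltW/dP => //; apply: (le_lt_trans xy).
rewrite /mesh mulrA ltr_pdivrMr ?ltr0n// -ltr_pdivrMl// mulrC.
exact: truncnS_gt.
Qed.

(** * Coded acts and the sequence of experiments *)

(** Codes are finite functions, which form a countable type, so that pairs of them can be
    pickled. *)
Definition code_act (R : realType) (a b : R) (ab : a < b) (S : finType)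
    (c : {ffun S -> nat * seq nat}) : Act a b S := fun s => code_meas ab (c s).

Lemma code_act_bracket (R : realType) (a b : R) (ab : a < b) (S : finType)
    (f : Act a b S) (U : set (Act a b S)) :
  nbhsX f U -> exists cu cl V, [/\ U (code_act ab cu), U (code_act ab cl),
    nbhsX f V & forall g, V g ->
      act_ge (code_act ab cu) g /\ act_ge g (code_act ab cl)].
Proof.
move=> [n [hs [e [hc [e0 hU]]]]].
(* With oscillation [e / 4], the error [3 * (e / 4)] stays below the radius [e]. *)
have [N hN] := osc_mesh ab hc (divr_gt0 e0 (ltr0n R 4)).
have [cu /choice[cl H]] := choice (fun s => code_bracket ab N (f s)).
exists (finfun cu), (finfun cl),
  (basic_nbhs f (fun i : 'I_N.+1 => ramp a b N i) N.+1%:R^-1); split.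
- apply: hU => j s; rewrite /code_act ffunE.
  by have [/(_ _ _ (hc j) (hN j))[+ _] _] := H s; lra.
- apply: hU => j s; rewrite /code_act ffunE.
  by have [/(_ _ _ (hc j) (hN j))[_ +] _] := H s; lra.
- exists N.+1, (fun i : 'I_N.+1 => ramp a b N i), N.+1%:R^-1; split.
    by move=> j; exact: continuous_ramp.
  by split; [rewrite invr_gt0 ltr0n|].
- move=> g gV; split=> s; rewrite /code_act ffunE;
  have [_ /(_ (g s) (fun i => gV i s))[]] := H s; by [].
Qed.

Lemma nbhsX_self (R : realType) (a b : R) (S : finType) (f : Act a b S)
    (U : set (Act a b S)) : nbhsX f U -> U f.
Proof.
by move=> [n [hs [e [_ [e0 hU]]]]]; apply: hU => j s; rewrite subrr normr0.
Qed.

(** An index that decodes to nothing yields a default pair of coded acts, so the union of the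
    experiments is still the set of coded acts. *)
Definition code_pairs (R : realType) (a b : R) (ab : a < b) (S : finType) (n : nat) :
    Act a b S * Act a b S :=
  let: (c, c') := odflt ([ffun=> (0%N, [::])], [ffun=> (0%N, [::])])
    (unpickle n : option ({ffun S -> nat * seq nat} * {ffun S -> nat * seq nat})) in
  (code_act ab c, code_act ab c').

Lemma code_pairs_pickle (R : realType) (a b : R) (ab : a < b) (S : finType)
    (c c' : {ffun S -> nat * seq nat}) :
  code_pairs ab S (pickle (c, c')) = (code_act ab c, code_act ab c').
Proof. by rewrite /code_pairs pickleK. Qed.

Lemma union_code_pairs (R : realType) (a b : R) (ab : a < b) (S : finType) :
  union_B (code_pairs ab S) = range (@code_act R a b ab S).
Proof.
apply/seteqP; split=> [x [i]|_ [c _ <-]].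
  rewrite /in_pair /code_pairs; case: (odflt _ _) => c c' /= [->|->].
    by exists c.
  by exists c'.
by exists (pickle (c, c)); rewrite code_pairs_pickle; left.
Qed.

(** Totality gives reflexivity, so [x] is chosen from the pair exactly when it is weakly preferred
    to [y]. *)
Lemma rationalizes_pair (R : realType) (a b : R) (S : finType)
    (B : nat -> Act a b S * Act a b S) (k i : nat) (prk pr : Act a b S -> Act a b S -> Prop)
    (x y : Act a b S) :
  (forall f g, pr f g \/ pr g f) -> (forall f g, prk f g \/ prk g f) ->
  strongly_rationalizes B k prk pr -> (i < k)%N -> B i = (x, y) ->
  prk x y <-> pr x y.
Proof.
move=> tot totk rat ik Bi.
have E (r : Act a b S -> Act a b S -> Prop) : (forall f g, r f g \/ r g f) ->
    choice_of r (B i) x <-> r x y.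
  move=> rtot; rewrite Bi; split=> [[_]|rxy]; first by apply; right.
  by split; [left|move=> _ [->|->] //=; case: (rtot x x)].
by rewrite -E// -(E pr)// (rat i ik).
Qed.

Theorem mainTheorem7 (R : realType) (a b : R) (S : finType) :
  a < b -> (0 < #|S|)%N ->
  exists B : nat -> Act a b S * Act a b S,
    standing_assumptions B /\
    forall (pr : Act a b S -> Act a b S -> Prop)
           (prk : nat -> Act a b S -> Act a b S -> Prop),
      continuous_pref pr -> weakly_monotone pr ->
      (forall k, continuous_pref (prk k) /\ weakly_monotone (prk k) /\
                 strongly_rationalizes B k (prk k) pr) ->
      closed_conv (fun k => graph (prk k)) (graph pr).
Proof.
move=> ab _; exists (code_pairs ab S); split.
  rewrite /standing_assumptions union_code_pairs; split=> [f U fU|].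
    have [cu [_ [_ [Ucu _ _ _]]]] := code_act_bracket ab fU.
    by exists (code_act ab cu); split=> //; exists cu.
  move=> _ _ [c _ <-] [c' _ <-]; exists (pickle (c, c')).
  by left; exact: code_pairs_pickle.
move=> pr prk [tot trans closed] mono H.
have agree c c' k : (pickle (c, c') < k)%N ->
    prk k (code_act ab c) (code_act ab c') <-> pr (code_act ab c) (code_act ab c').
  move=> ck; have [[totk _ _] [_ rat]] := H k.
  exact: rationalizes_pair tot totk rat ck (code_pairs_pickle _ _ _).
have GLi : graph pr `<=` Li (fun k => graph (prk k)).
  move=> [f g] /= fg W [U [V [fU [gV UVW]]]].
  have [cu [_ [U' [Ucu _ fU' /(_ f (nbhsX_self fU'))[uf _]]]]] := code_act_bracket ab fU.
  have [_ [cl [V' [_ Vcl gV' /(_ g (nbhsX_self gV'))[_ gl]]]]] := code_act_bracket ab gV.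
  (* From this index on, the experiment on [cu] and [cl] is among those rationalized, so [prk k]
     inherits the chain [cu >= f], [f] preferred to [g], [g >= cl]. *)
  exists (pickle (cu, cl)).+1 => k ck.
  exists (code_act ab cu, code_act ab cl); split; first exact: UVW.
  apply/agree => //; apply: (trans _ _ _ (mono _ _ uf)).
  exact: trans fg (mono _ _ gl).
have LiLs : Li (fun k => graph (prk k)) `<=` Ls (fun k => graph (prk k)).
  move=> z zLi W zW N; have [M /(_ (maxn N M))] := zLi W zW.
  by move=> /(_ (leq_maxr _ _)) Wn; exists (maxn N M); [exact: leq_maxl|].
have LsG : Ls (fun k => graph (prk k)) `<=` graph pr.
  move=> [f g] fgLs; apply: closed => W [U [V [fU [gV UVW]]]].
  have [cu [cl0 [U' [Ucu _ fU' uU']]]] := code_act_bracket ab fU.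
  have [cu0 [cl [V' [_ Vcl gV' lV']]]] := code_act_bracket ab gV.
  have UV' : nbhsXX (f, g) (U' `*` V') by exists U', V'; split=> //; split.
  (* The brackets hold on all of [U'] and [V'], hence [cu] and [cl] are fixed before [k], and [k]
     can be taken past their experiment. *)
  have [k ck [[f' g'] [[/= U'f V'g] fg]]] := fgLs _ UV' (pickle (cu, cl)).+1.
  have [uf _] := uU' _ U'f; have [_ gl] := lV' _ V'g.
  exists (code_act ab cu, code_act ab cl); split; first exact: UVW.
  have [[_ transk _] [monok _]] := H k.
  apply/(agree _ _ k ck); apply: (transk _ _ _ (monok _ _ uf)).
  exact: transk fg (monok _ _ gl).
(* The cycle [graph pr], [Li], [Ls], [graph pr] of inclusions forces equality. *)
split; apply/seteqP; split=> //.
- exact: subset_trans LsG.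
- exact: subset_trans LiLs.
Qed.
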